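(* Suppose Assumptions 1–3 hold, $\Pi_{2u}\Pi_{2u}^\top\succ0$, and $\mu\ge\max\{\hat L_f,L_h\}$. Then there exist $\epsilon>0$, $\rho>0$, $\varphi_1,\varphi_2\ge0$ and a matrix $\mathbf P\succ0$ such that $\mathbf A_{\epsilon\rho}$ satisfies $\mathrm{LMI}(\mathbf P,\Xi_\varphi)$.
   Context: Let $A\in\mathbb R^{n\times n}$ be Hurwitz, $B\in\mathbb R^{n\times p}$, $B_w\in\mathbb R^{n\times q}$, and for $i=1,2$ let $C_i\in\mathbb R^{r_i\times n}$, $D_{iw}\in\mathbb R^{r_i\times q}$. Define $\Pi_{iu}:=-C_iA^{-1}B$ and $\Pi_{iw}:=-C_iA^{-1}B_w+D_{iw}$. For $t\ge0$ let $f^t:\mathbb R^p\to\mathbb R$, $h^t:\mathbb R^{r_1}\to\mathbb R$ and $g^t:\mathbb R^{r_2}\to\mathbb R\cup\{+\infty\}$ be given, let $w:[0,\infty)\to\mathbb R^q$, and fix $\mu>0$. Definitions. - $M_{\mu g}(v):=\min_x g(x)+\frac1{2\mu}\|x-v\|^2$ is the Moreau envelope, with $\nabla M_{\mu g}(v)=\frac1\mu(v-\mathbf{prox}_{\mu g}(v))$, where $\mathbf{prox}_{\mu g}(v)$ is the minimizer. - $\mathcal P(t)$: minimize $f^t(u)+h^t(y_1)+g^t(y_2)$ subject to $y_i=\Pi_{iu}u+\Pi_{iw}w(t)$. - Its optimal primal-dual pairs are saddle points of $f^t(u)+h^t(\Pi_{1u}u+\Pi_{1w}w(t))+M_{\mu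 g^t}(\Pi_{2u}u+\Pi_{2w}w(t)+\mu\lambda)-\frac\mu2\|\lambda\|^2$. Assumptions. - Assumption 1: for all $t$, $f^t$ is $m$-strongly convex with $L_f$-Lipschitz gradient, $h^t$ is convex with $L_h$-Lipschitz gradient, and $g^t$ is proper, convex and lsc. - Assumption 2: $\mathcal P(t)$ is feasible for all $t\ge0$ and $t\mapsto(u^\star(t),\lambda^\star(t))$ is measurable. - Assumption 3: the right-hand side of the closed-loop system $\dot x=Ax+Bu+B_ww$, $\dot u=-\nabla f^t(u)-\Pi_{1u}^\top\nabla h^t(y_1)-\Pi_{2u}^\top\nabla M_{\mu g^t}(y_2+\mu\lambda)$, $\dot\lambda=\mu(\nabla M_{\mu g^t}(y_2+\mu\lambda)-\lambda)$, $y_i=C_ix+D_{iw}w(t)$, is measurable in $t$ and continuous for almost all $t$. Matrices. Let $\hat L_f:=L_f-m$. For $\epsilon>0$ and $\rho\ge0$ define $$\mathbf A_\epsilon:=\begin{bmatrix}\frac1\epsilon A&\frac1\epsilon B&0\\0&-mI&0\\0&0&-\mu I\end{bmatrix},\qquad \mathbf A_{\epsilon\rho}:=\mathbf A_\epsilon+\rho I,$$ $$\mathbf B=\begin{bmatrix}0&0&0\\-I&-\Pi_{1u}^\top&-\frac1\mu\Pi_{2u}^\top\\0&0&I\end{bmatrix},\qquad \mathbf C=\begin{bmatrix}0&I&0\\C_1&0&0\\C_2&0&\mu I\end{bmatrix}.$$ ($\mathbf A_\epsilon$ corresponds to the closed loop with the physical system sped up to $\epsilon\dot x=Ax+Bu+B_ww$.)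 LMI condition. For $\varphi_1,\varphi_2\ge0$, $\Xi_\varphi$ is the $6\times6$ block matrix, with block sizes $(p,r_1,r_2,p,r_1,r_2)$, whose nonzero blocks are: - $(1,4)=(4,1)=\varphi_1\hat L_fI$ and $(4,4)=-2\varphi_1I$; - $(2,5)=(5,2)=\varphi_2L_hI$ and $(5,5)=-2\varphi_2I$; - $(3,6)=(6,3)=I$ and $(6,6)=-2I$. A matrix $\mathbf A'$ satisfies $\mathrm{LMI}(\mathbf P,\Xi_\varphi)$ if $\begin{bmatrix}\mathbf A'^\top\mathbf P+\mathbf P\mathbf A'&\mathbf P\mathbf B\\\mathbf B^\top\mathbf P&0\end{bmatrix}+\begin{bmatrix}\mathbf C^\top&0\\0&I\end{bmatrix}\Xi_\varphi\begin{bmatrix}\mathbf C&0\\0&I\end{bmatrix}\preceq0$. *)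

(* Defs.v *)
From HB Require Import structures.
From mathcomp Require Import all_boot all_order all_algebra.
From mathcomp Require Import all_classical all_reals all_analysis.
From mathcomp Require Import complex.
Import numFieldNormedType.Exports.
Set Implicit Arguments. Unset Strict Implicit. Unset Printing Implicit Defensive.
Import Order.TTheory GRing.Theory Num.Theory.
Local Open Scope ring_scope.

Section Defs.
Variable R : realType.

Definition dotv (k : nat) (u v : 'cV[R]_k) : R := (u^T *m v) 0 0.
Definition norm2 (k : nat) (v : 'cV[R]_k) : R := Num.sqrt (dotv v v).

Definition qform (k : nat) (M : 'M[R]_k) (x : 'cV[R]_k) : R := (x^T *m M *m x) 0 0.

Definition posdef (k : nat) (M : 'M[R]_k) : Prop :=
  M^T = M /\ forall x : 'cV[R]_k, x != 0 -> 0 < qform M x.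

Definition negsemidef (k : nat) (M : 'M[R]_k) : Prop :=
  M^T = M /\ forall x : 'cV[R]_k, qform M x <= 0.

Definition hurwitz (k : nat) (A : 'M[R]_k) : Prop :=
  forall z : R[i], eigenvalue (map_mx (fun x : R => (x%:C)%C) A) z -> complex.Re z < 0.

Definition is_gradient (k : nat) (f : 'cV[R]_k -> R) (df : 'cV[R]_k -> 'cV[R]_k) : Prop :=
  forall x, differentiable f x /\ forall v, 'd f x v = dotv (df x) v.

Definition convex_fun (k : nat) (f : 'cV[R]_k -> R) : Prop :=
  forall (x y : 'cV[R]_k) (l : R), 0 <= l <= 1 ->
    f (l *: x + (1 - l) *: y) <= l * f x + (1 - l) * f y.

Definition strongly_convex (k : nat) (m : R) (f : 'cV[R]_k -> R) : Prop :=
  0 < m /\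
  forall (x y : 'cV[R]_k) (l : R), 0 <= l <= 1 ->
    f (l *: x + (1 - l) *: y) <=
      l * f x + (1 - l) * f y - m / 2 * l * (1 - l) * (norm2 (x - y)) ^+ 2.

Definition lipschitz_with (k : nat) (L : R) (F : 'cV[R]_k -> 'cV[R]_k) : Prop :=
  forall x y, norm2 (F x - F y) <= L * norm2 (x - y).

Definition proper_efun (k : nat) (g : 'cV[R]_k -> \bar R) : Prop :=
  (exists x, (g x < +oo)%E) /\ forall x, (-oo < g x)%E.

Definition convex_efun (k : nat) (g : 'cV[R]_k -> \bar R) : Prop :=
  forall (x y : 'cV[R]_k) (l : R), 0 <= l <= 1 ->
    (g (l *: x + (1 - l) *: y)%R <= l%:E * g x + (1 - l)%:E * g y)%E.

Definition assumption1 (p r1 r2 : nat) (m Lf Lh : R)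
  (f : R -> 'cV[R]_p -> R) (df : R -> 'cV[R]_p -> 'cV[R]_p)
  (h : R -> 'cV[R]_r1 -> R) (dh : R -> 'cV[R]_r1 -> 'cV[R]_r1)
  (g : R -> 'cV[R]_r2 -> \bar R) : Prop :=
  forall t : R, 0 <= t ->
    (is_gradient (f t) (df t) /\ strongly_convex m (f t) /\ lipschitz_with Lf (df t)) /\
    (is_gradient (h t) (dh t) /\ convex_fun (h t) /\ lipschitz_with Lh (dh t)) /\
    (proper_efun (g t) /\ convex_efun (g t) /\ lower_semicontinuous (g t)).

Definition Piu (n p r : nat) (A : 'M[R]_n) (B : 'M[R]_(n, p)) (C : 'M[R]_(r, n))
  : 'M[R]_(r, p) := - (C *m invmx A *m B).

Definition diag3 (p r1 r2 : nat) (a b c : R) : 'M[R]_(p + r1 + r2) :=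
  block_mx (block_mx (a%:M : 'M[R]_p) 0 0 (b%:M : 'M[R]_r1)) 0 0 (c%:M : 'M[R]_r2).

(* bold A_epsilon, on the state (x, u, lambda) *)
Definition Aeps (n p r2 : nat) (A : 'M[R]_n) (B : 'M[R]_(n, p)) (m mu eps : R)
  : 'M[R]_(n + p + r2) :=
  block_mx (block_mx (eps^-1 *: A) (eps^-1 *: B) 0 (- m%:M)) 0 0 (- mu%:M).

Definition Aepsrho (n p r2 : nat) (A : 'M[R]_n) (B : 'M[R]_(n, p)) (m mu eps rho : R)
  : 'M[R]_(n + p + r2) := Aeps r2 A B m mu eps + rho%:M.

Definition Bbold (n p r1 r2 : nat) (P1u : 'M[R]_(r1, p)) (P2u : 'M[R]_(r2, p)) (mu : R)
  : 'M[R]_(n + p + r2, p + r1 + r2) :=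
  block_mx (col_mx (0 : 'M[R]_(n, p + r1)) (row_mx (- (1%:M : 'M[R]_p)) (- P1u^T)))
           (col_mx (0 : 'M[R]_(n, r2)) (- (mu^-1 *: P2u^T)))
           (0 : 'M[R]_(r2, p + r1)) (1%:M : 'M[R]_r2).

Definition Cbold (n p r1 r2 : nat) (C1 : 'M[R]_(r1, n)) (C2 : 'M[R]_(r2, n)) (mu : R)
  : 'M[R]_(p + r1 + r2, n + p + r2) :=
  block_mx (col_mx (row_mx (0 : 'M[R]_(p, n)) (1%:M : 'M[R]_p)) (row_mx C1 (0 : 'M[R]_(r1, p))))
           (0 : 'M[R]_(p + r1, r2))
           (row_mx C2 (0 : 'M[R]_(r2, p))) (mu%:M : 'M[R]_r2).

Definition Xi (p r1 r2 : nat) (hLf Lh phi1 phi2 : R) : 'M[R]_(p + r1 + r2 + (p + r1 + r2)) :=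
  block_mx 0 (diag3 p r1 r2 (phi1 * hLf) (phi2 * Lh) 1)
           (diag3 p r1 r2 (phi1 * hLf) (phi2 * Lh) 1)
           (diag3 p r1 r2 (-2 * phi1) (-2 * phi2) (-2)).

Definition LMI (N K : nat) (A' : 'M[R]_N) (Bb : 'M[R]_(N, K)) (Cb : 'M[R]_(K, N))
  (P : 'M[R]_N) (X : 'M[R]_(K + K)) : Prop :=
  let CI : 'M[R]_(K + K, N + K) := block_mx Cb 0 0 (1%:M : 'M[R]_K) in
  negsemidef (block_mx (A'^T *m P + P *m A') (P *m Bb) (Bb^T *m P) (0 : 'M[R]_K)
              + CI^T *m X *m CI).

End Defs.

(* Main.v *)
Require Import Defs.
From HB Require Import structures.
From mathcomp Require Import all_boot all_order all_algebra.
From mathcomp Require Import all_classical all_reals all_analysis.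
From mathcomp Require Import complex ring lra.
Import numFieldNormedType.Exports.
Import Order.TTheory GRing.Theory Num.Theory.
Local Open Scope ring_scope.
Set Implicit Arguments. Unset Strict Implicit. Unset Printing Implicit Defensive.

(* The proof is a singular perturbation argument. Let G = A^-1 B and xi = x + G u, so
    that xi = 0 is the slow manifold, and let P0 be a Lyapunov matrix of A. The matrix P
    is that of the quadratic form
      V = xi^T P0 xi + mu |u|^2 + mu |l|^2 + 2 gam <u, Pi_2u^T l>.
    On the slow manifold, the multipliers phi_1 and phi_2 are chosen so that the terms
    <u, a> and <Pi_1u u, b> essentially cancel, and the rest is a sum of squares
    containing - 2 |c - mu l|^2. It is degenerate only along c = mu l, where the coupling
    gam yields - 2 gam |Pi_2u^T l|^2, which is definite as Pi_2u Pi_2u^T > 0. For small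
    gam the form is thus negative definite in (u, l, a, b, c), and a small eps makes
    - |xi|^2 / eps dominate all the terms containing xi, with room left for a small rho. *)

(** * Inner products of column vectors: Young, Cauchy-Schwarz and operator bounds *)

Section Dot.
Context {R : realType}.

Lemma dotvE k (u v : 'cV[R]_k) : dotv u v = \sum_i u i 0 * v i 0.
Proof. by rewrite /dotv mxE; apply: eq_bigr => i _; rewrite mxE. Qed.

Lemma dotvC k (u v : 'cV[R]_k) : dotv u v = dotv v u.
Proof. by rewrite !dotvE; apply: eq_bigr => i _; rewrite mulrC. Qed.

Lemma dotvDr k (u v w : 'cV[R]_k) : dotv u (v + w) = dotv u v + dotv u w.
Proof. by rewrite /dotv mulmxDr mxE. Qed.

Lemma dotvDl k (u v w : 'cV[R]_k) : dotv (u + v) w = dotv u w + dotv v w.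
Proof. by rewrite dotvC dotvDr !(dotvC w). Qed.

Lemma dotvZr k (u v : 'cV[R]_k) a : dotv u (a *: v) = a * dotv u v.
Proof. by rewrite /dotv -scalemxAr mxE. Qed.

Lemma dotvZl k (u v : 'cV[R]_k) a : dotv (a *: u) v = a * dotv u v.
Proof. by rewrite dotvC dotvZr dotvC. Qed.

Lemma dotvNr k (u v : 'cV[R]_k) : dotv u (- v) = - dotv u v.
Proof. by rewrite -scaleN1r dotvZr mulN1r. Qed.

Lemma dotvNl k (u v : 'cV[R]_k) : dotv (- u) v = - dotv u v.
Proof. by rewrite dotvC dotvNr dotvC. Qed.

Lemma dotv0r k (u : 'cV[R]_k) : dotv u 0 = 0.
Proof. by rewrite /dotv mulmx0 mxE. Qed.

Lemma dotv_mulmxr k l (u : 'cV[R]_k) (M : 'M[R]_(k, l)) v :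
  dotv u (M *m v) = dotv (M^T *m u) v.
Proof. by rewrite /dotv trmx_mul trmxK mulmxA. Qed.

Lemma dotv_ge0 k (u : 'cV[R]_k) : 0 <= dotv u u.
Proof. by rewrite dotvE sumr_ge0 // => i _; rewrite -expr2 sqr_ge0. Qed.

Lemma dotv_gt0 k (u : 'cV[R]_k) : (0 < dotv u u) = (u != 0).
Proof.
rewrite lt_def dotv_ge0 andbT; congr (~~ _); apply/eqP/eqP => [|->]; last first.
  exact: dotv0r.
rewrite dotvE => /psumr_eq0P u0; apply/colP => i; rewrite mxE.
by apply/eqP; rewrite -sqrf_eq0 expr2 u0 // => j _; rewrite -expr2 sqr_ge0.
Qed.

Lemma norm2_sqr k (u : 'cV[R]_k) : norm2 u ^+ 2 = dotv u u.
Proof. by rewrite sqr_sqrtr // dotv_ge0. Qed.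

(** Expand [0 <= d^-1 |u - d v|^2]. *)
Lemma dotv_young k (u v : 'cV[R]_k) d : 0 < d ->
  2 * dotv u v <= d^-1 * dotv u u + d * dotv v v.
Proof.
move=> d0; have := dotv_ge0 (u - d *: v).
rewrite !(dotvDl, dotvDr, dotvNl, dotvNr, dotvZl, dotvZr) (dotvC v u) => h.
have d'0 : 0 <= d^-1 by rewrite invr_ge0 ltW.
rewrite -subr_ge0; apply: le_trans (mulr_ge0 d'0 h) _.
by rewrite le_eqVlt; apply/orP; left; apply/eqP; field; rewrite gt_eqF.
Qed.

(** Young's inequality with weight [|u| / |v|], which makes both of its terms equal to [|u| |v|].
    The weight is positive only for nonzero vectors, hence the two degenerate cases. *)
Lemma dotv_CS k (u v : 'cV[R]_k) : dotv u v <= norm2 u * norm2 v.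
Proof.
have [->|v0] := eqVneq v 0; first by rewrite dotv0r mulr_ge0 ?sqrtr_ge0.
have [->|u0] := eqVneq u 0; first by rewrite dotvC dotv0r mulr_ge0 ?sqrtr_ge0.
have nu : 0 < norm2 u by rewrite sqrtr_gt0 dotv_gt0.
have nv : 0 < norm2 v by rewrite sqrtr_gt0 dotv_gt0.
have := dotv_young u v (divr_gt0 nu nv).
rewrite -!norm2_sqr invf_div.
have -> : norm2 v / norm2 u * norm2 u ^+ 2 + norm2 u / norm2 v * norm2 v ^+ 2
  = 2 * (norm2 u * norm2 v) by field; rewrite !gt_eqF.
by rewrite ler_pM2l.
Qed.

(** Cauchy-Schwarz on each row of [M]. The constant is the squared Frobenius norm, plus one so that
    it stays positive for [M = 0]. *)
Lemma dotv_mulmx_bound k l (M : 'M[R]_(k, l)) :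
  exists2 K, 0 < K & forall v, dotv (M *m v) (M *m v) <= K * dotv v v.
Proof.
exists (1 + \sum_i dotv (row i M)^T (row i M)^T).
  by rewrite ltr_wpDr // sumr_ge0 // => i _; exact: dotv_ge0.
move=> v; rewrite mulrDl mul1r ler_wpDl ?dotv_ge0 // dotvE mulr_suml ler_sum // => i _.
have -> : (M *m v) i 0 = dotv (row i M)^T v.
  by rewrite dotvE mxE; apply: eq_bigr => j _; rewrite !mxE.
rewrite -expr2 -!norm2_sqr -exprMn -ler_sqrt ?sqr_ge0 // !sqrtr_sqr.
rewrite [leRHS]ger0_norm ?mulr_ge0 ?sqrtr_ge0 // ler_norml dotv_CS andbT.
rewrite lerNl -dotvNl.
by apply: le_trans (dotv_CS _ _) _; rewrite /norm2 dotvNl dotvNr opprK.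
Qed.

(** Moving [M] onto [u] lets the weight [d] of [|v|^2] be prescribed in advance, the whole cost
    falling on [|u|^2]. *)
Lemma dotv_mulmx_young k l (M : 'M[R]_(k, l)) d : 0 < d ->
  exists2 K, 0 < K &
  forall u v, 2 * dotv u (M *m v) <= K * dotv u u + d * dotv v v.
Proof.
move=> d0; have [K K0 hK] := dotv_mulmx_bound M^T.
exists (d^-1 * K) => [|u v]; first by rewrite mulr_gt0 ?invr_gt0.
rewrite dotv_mulmxr; apply: le_trans (dotv_young _ _ d0) _.
by rewrite lerD2r -mulrA ler_pM2l ?invr_gt0.
Qed.

End Dot.

(** * Strong convexity and the Lipschitz constant of the gradient *)

Lemma strongly_convex_gradient {R : realType} k m (f : 'cV[R]_k -> R) df x y :
  is_gradient f df -> strongly_convex m f ->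
  f y + dotv (df y) (x - y) + m / 2 * dotv (x - y) (x - y) <= f x.
Proof.
move=> gf [m0 sf]; set v := x - y.
have [dfy dfE] := gf y.
have dv : derivable f y v by apply: diff_derivable.
have : 'D_v f y = dotv (df y) v by rewrite deriveE // dfE.
suff : 'D_v f y <= f x - f y - m / 2 * dotv v v by move=> + <-; lra.
set c := m / 2 * dotv v v.
(* Strong convexity on the segment bounds the difference quotient by [f x - f y - c + c * h].
   Subtracting [c * h] makes the bound independent of [h] and does not change the limit. *)
have cv : ((h^-1 *: (f (h *: v + y) - f y) - c * h) @[h --> 0^'+] --> 'D_v f y)%classic.
  rewrite -[X in (_ --> X)%classic]subr0; apply: cvgB.
    by apply: cvg_dnbhs_at_right; exact: dv.
  rewrite -[X in (_ --> X)%classic](mulr0 c); apply: cvgM; first exact: cvg_cst.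
  exact: cvg_at_right_filter (@cvg_id _ _).
rewrite -(cvg_lim (@Rhausdorff R) cv); apply: limr_le; first exact: cvgP cv.
near=> h.
have h0 : 0 < h by near: h; exact: nbhs_right_gt.
have h1 : h < 1 by near: h; exact: nbhs_right_lt.
have := sf x y h; rewrite (ltW h0) (ltW h1) => /(_ isT).
have -> : h *: x + (1 - h) *: y = h *: v + y.
  by rewrite scalerBl scale1r scalerBr addrA addrAC.
rewrite norm2_sqr -/v => hf.
rewrite /GRing.scale/= lerBlDr ler_pdivrMl //; rewrite /c; nra.
Unshelve. all: by end_near.
Qed.

(** Adding the first-order inequalities between [0] and a nonzero [v] gives
    [m |v|^2 <= <df v - df 0, v>], and Cauchy-Schwarz bounds the right side by [L |v|^2]. This
    supplies the sign of [Lf - m]. *)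
Lemma gradient_lipschitz_ge {R : realType} k m L (f : 'cV[R]_k -> R) df :
  (0 < k)%N -> is_gradient f df -> strongly_convex m f -> lipschitz_with L df ->
  m <= L.
Proof.
move=> k0 gf sf Lf; set v : 'cV[R]_k := const_mx 1.
have v0 : 0 < dotv v v.
  by rewrite dotv_gt0; apply/eqP => /colP/(_ (Ordinal k0))/eqP; rewrite !mxE oner_eq0.
have h1 := strongly_convex_gradient v 0 gf sf.
have h2 := strongly_convex_gradient 0 v gf sf.
rewrite !(subr0, sub0r) !(dotvNr, dotvNl) in h1 h2.
have : dotv (df v - df 0) v <= L * dotv v v.
  apply: le_trans (dotv_CS _ _) _; rewrite -norm2_sqr expr2 mulrA.
  by rewrite ler_wpM2r ?sqrtr_ge0 //; have := Lf v 0; rewrite subr0.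
rewrite dotvDl dotvNl => h3; rewrite -(ler_pM2r v0); lra.
Qed.

(** * Real and imaginary parts of complex matrices *)

Definition complexmx {R : realType} k l (X Y : 'M[R]_(k, l)) : 'M[R[i]]_(k, l) :=
  map_mx (real_complex R) X + 'i%C *: map_mx (real_complex R) Y.

Section Re.
Context {R : realType}.

Lemma complexmxE k l (M : 'M[R[i]]_(k, l)) :
  M = complexmx (map_mx (@complex.Re R) M) (map_mx (@complex.Im R) M).
Proof. by apply/matrixP => i j; rewrite !mxE -complexE. Qed.

Lemma complexmxM k l q (X Y : 'M[R]_(k, l)) (X' Y' : 'M[R]_(l, q)) :
  complexmx X Y *m complexmx X' Y' =
  complexmx (X *m X' - Y *m Y') (X *m Y' + Y *m X').
Proof.
rewrite /complexmx mulmxDl !mulmxDr -!scalemxAl -!scalemxAr scalerA.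
rewrite -expr2 sqr_i scaleN1r -!map_mxM map_mxB map_mxD scalerDr.
rewrite [X in _ + X = _]addrC addrACA.
by [].
Qed.

Lemma complexmx_inj k l (X Y X' Y' : 'M[R]_(k, l)) :
  complexmx X Y = complexmx X' Y' -> X = X' /\ Y = Y'.
Proof.
move=> /matrixP e; split; apply/matrixP => i j; have := e i j; rewrite !mxE.
  by move=> /(congr1 (@complex.Re R)); rewrite /=; simpc.
by move=> /(congr1 (@complex.Im R)); rewrite /=; simpc.
Qed.

Lemma complexmx1 k : 1%:M = complexmx (1%:M : 'M[R]_k) 0.
Proof. by rewrite /complexmx map_scalar_mx map_mx0 scaler0 addr0. Qed.

End Re.

(** * Lyapunov matrices of Hurwitz matrices *)

Section Lyap.
Context {R : realType}.

(** A nontrivial kernel would make [0] an eigenvalue, whose real part is not negative. *)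
Lemma hurwitz_unitmx k (A : 'M[R]_k) : hurwitz A -> A \in unitmx.
Proof.
move=> hA; rewrite -(map_unitmx (real_complex R)) -row_free_unit -kermx_eq0.
apply: contraT => nz; have := hA 0; rewrite ltxx; apply.
by rewrite /eigenvalue /eigenspace raddf0 subr0.
Qed.

(* Conjugating a triangularization by [diag (s ^ i)] multiplies the entry [(i, j)]
   by [s ^ (i - j)], so the off-diagonal part can be made arbitrarily small. *)
Lemma hurwitz_trig n (A : 'M[R]_n) : hurwitz A -> exists2 c, 0 < c &
  forall d, 0 < d -> exists S T : 'M[R[i]]_n, [/\ S \in unitmx,
    S *m map_mx (real_complex R) A = T *m S,
    forall i, complex.Re (T i i) <= - c &
    forall i j, i != j -> `|complex.Re (T i j)| <= d /\ `|complex.Im (T i j)| <= d].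
Proof.
case: n A => [|n] A hA.
  by exists 1 => // d d0; exists 1%:M, 1%:M; split; rewrite ?unitmx1 ?mul1mx ?mulmx1 //;
     [apply/matrixP => -[] | case | case].
have [P /unitarymx_unit Pu] := Schur (map_mx (real_complex R) A) isT.
rewrite /similar_to /= => trigT; set T := conjmx P _ in trigT.
have PA : P *m map_mx (real_complex R) A = T *m P.
  by rewrite /T /conjmx pinvmxE // mulmxKV.
(* The diagonal entries of the triangular [T] are roots of its characteristic polynomial, hence
   eigenvalues of [A]. *)
have Tii i : complex.Re (T i i) < 0.
  apply: hA; apply: (@eigenvalue_conjmx _ _ _ P).
  - by rewrite PA submxMl.
  - by rewrite row_free_unit.
  rewrite [_ \in _]eigenvalue_root_char (char_poly_trig trigT) rootE horner_prod.
  by rewrite (bigD1 i) //= !hornerE subrr mul0r.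
clearbody T; have ReT_inv_ge0 i : 0 <= (- complex.Re (T i i))^-1 by rewrite invr_ge0 oppr_ge0 ltW.
have sum_gt0 : 0 < 1 + \sum_i (- complex.Re (T i i))^-1.
  by rewrite ltr_wpDr // sumr_ge0.
(* The inverse of this sum lies below every [- Re (T i i)], since each inverse is one of its
   summands. *)
exists (1 + \sum_i (- complex.Re (T i i))^-1)^-1 => [|d d0]; first by rewrite invr_gt0.
pose K : R := \sum_i \sum_j (`|complex.Re (T i j)| + `|complex.Im (T i j)|).
have KT i j : `|complex.Re (T i j)| + `|complex.Im (T i j)| <= K.
  apply: (@le_trans _ _ (\sum_j0 (`|complex.Re (T i j0)| + `|complex.Im (T i j0)|))).
    by rewrite (bigD1 j) //= lerDl sumr_ge0 // => *; rewrite addr_ge0.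
  rewrite /K [leRHS](bigD1 i) //= lerDl sumr_ge0 // => *.
  by rewrite sumr_ge0 // => *; rewrite addr_ge0.
have K0 : 0 <= K by apply: le_trans (KT ord0 ord0); rewrite addr_ge0.
(* [s <= 1] makes every positive power of [s] at most [s], and [s * K <= d] then bounds all the
   scaled off-diagonal entries, as [K] dominates every entry of [T]. *)
pose s := Num.min 1 (d / (1 + K)).
have s0 : 0 < s by rewrite lt_min ltr01 divr_gt0 // ltr_pwDl.
have s1 : s <= 1 by rewrite ge_min lexx.
have sK : s * K <= d.
  apply: (@le_trans _ _ (d / (1 + K) * K)).
    by rewrite ler_wpM2r // ge_min lexx orbT.
  by rewrite mulrAC ler_pdivrMr ?ltr_pwDl // ler_wpM2l ?ltW //; lra.
pose D := diag_mx (\row_(i < n.+1) (s ^+ i)%:C%C).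
pose E := diag_mx (\row_(i < n.+1) (s ^- i)%:C%C).
have ED : E *m D = 1%:M.
  apply/matrixP => i j; rewrite mul_diag_mx !mxE mulrnAr -rmorphM mulVf ?rmorph1 //.
  by rewrite expf_eq0 gt_eqF ?andbF.
have [_ Du] := mulmx1_unit ED.
have TE i j : (D *m T *m E) i j = (s ^+ i / s ^+ j)%:C%C * T i j.
  by rewrite mul_mx_diag mxE mul_diag_mx !mxE mulrAC rmorphM.
exists (D *m P), (D *m T *m E); split.
- by rewrite unitmx_mul Du Pu.
- by rewrite -!mulmxA (mulmxA E) ED mul1mx PA.
- move=> i; rewrite TE mulfV ?mul1r; last first.
    by rewrite expf_eq0 gt_eqF ?andbF.
  rewrite lerNr -[leRHS]invrK lef_pV2 ?posrE ?invr_gt0 ?oppr_gt0 //.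
  by rewrite (bigD1 i) //= addrCA lerDl addr_ge0 // sumr_ge0.
move=> i j ij; rewrite TE; case: (ltngtP i j) => [ltij|ltji|]; last first.
- by move/ord_inj => e; rewrite e eqxx in ij.
- have sij : 0 <= s ^+ i / s ^+ j <= s.
    rewrite -expfB // exprn_ge0 ?(ltW s0) //=.
    by case: (i - j)%N (subn_gt0 j i) => [|k _]; rewrite ?ltji // exprS ler_piMr ?exprn_ile1 ?(ltW s0).
  case/andP: sij; move: (_ / _) => r q0 qs; have := KT i j; case: (T i j) => x y /= xy.
  simpc; rewrite /= !normrM (ger0_norm q0); split; apply: le_trans sK.
    by apply: ler_pM => //; apply: le_trans xy; rewrite lerDl.
  by apply: ler_pM => //; apply: le_trans xy; rewrite lerDr.
- by move/is_trig_mxP: trigT => -> //; rewrite mulr0 /= normr0 ltW.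
Qed.

(** The matrix is the real part of [S^* S], where [S] conjugates [A] to a nearly diagonal [T], so
    its form is [|S x|^2] in the complex norm. Along [A] it gives [2 Re <S x, T S x>], where the
    diagonal of [T] outweighs the small off-diagonal part. *)
Lemma hurwitz_lyapunov n (A : 'M[R]_n) : hurwitz A ->
  exists P : 'M[R]_n, posdef P /\
    exists2 c, 0 < c & forall x, 2 * dotv x (P *m A *m x) <= - c * dotv x x.
Proof.
move=> hA; have [c c0 trig] := hurwitz_trig hA.
(* This size gives [4 n d <= c], so that the off-diagonal terms use up at most half of the diagonal
   decay; [1 + n] keeps the denominator nonzero when [n = 0]. *)
have [|S [T [Su SA Tii Tij]]] := trig (c / (4 * (1 + n%:R))).
  by rewrite divr_gt0 // mulr_gt0 // ltr_wpDr.
set d := c / _ in Tij.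
have nd : 4 * n%:R * d <= c.
  rewrite /d mulrA ler_pdivrMr ?mulr_gt0 ?ltr_wpDr //.
  by have : 0 <= n%:R :> R by []; nra.
have d0 : 0 < d by rewrite divr_gt0 // mulr_gt0 // ltr_wpDr.
have := mulVmx Su; move: (invmx S) => S'.
rewrite (complexmxE S') (complexmxE S) complexmxM.
rewrite complexmx1 => /complexmx_inj[].
set X' := map_mx _ S'; set Y' := map_mx _ S'.
set X := map_mx _ S; set Y := map_mx _ S => SS _.
have Ac : map_mx (real_complex R) A = complexmx A 0.
  by rewrite /complexmx map_mx0 scaler0 addr0.
move: SA; rewrite {}Ac (complexmxE T) (complexmxE S) -/X -/Y !complexmxM.
set U := map_mx _ T; set W := map_mx _ T.
rewrite !mulmx0 subr0 add0r => /complexmx_inj[XA YA].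
pose Q x := dotv (X *m x) (X *m x) + dotv (Y *m x) (Y *m x).
have [K1 K10 hK1] := dotv_mulmx_bound X'.
have [K2 K20 hK2] := dotv_mulmx_bound Y'.
(* Coercivity of [Q]: the real part of [S^-1 S = 1] recovers [x] from [X x] and [Y x]. *)
have xQ x : dotv x x <= 2 * (K1 + K2) * Q x.
  have {1 2}-> : x = X' *m (X *m x) - Y' *m (Y *m x).
    by rewrite !mulmxA -mulmxBl SS mul1mx.
  have := dotv_young (X' *m (X *m x)) (- (Y' *m (Y *m x))) (ltr01 : 0 < 1 :> R).
  rewrite !(dotvDl, dotvDr, dotvNl, dotvNr) invr1.
  rewrite (dotvC (Y' *m _)).
  have := hK1 (X *m x); have := hK2 (Y *m x); rewrite /Q.
  have := dotv_ge0 (X *m x); have := dotv_ge0 (Y *m x).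
  nra.
have PE x y : dotv x ((X^T *m X + Y^T *m Y) *m y) =
    dotv (X *m x) (X *m y) + dotv (Y *m x) (Y *m y).
  by rewrite mulmxDl dotvDr -!mulmxA !dotv_mulmxr !trmxK.
have K0 : 0 < 2 * (K1 + K2) by rewrite mulr_gt0 // addr_gt0.
exists (X^T *m X + Y^T *m Y); split.
  split=> [|x x0]; first by rewrite linearD /= !trmx_mul !trmxK.
  have -> : qform (X^T *m X + Y^T *m Y) x = Q x by rewrite /qform -mulmxA -/(dotv _ _) PE.
  by rewrite -(pmulr_rgt0 _ K0); apply: lt_le_trans (xQ x); rewrite dotv_gt0.
exists (c / (2 * (K1 + K2))) => [|x]; first exact: divr_gt0.
apply: (@le_trans _ _ (- c * Q x)); last first.
  rewrite !mulNr lerN2 mulrAC ler_pdivrMr // -mulrA ler_pM2l //.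
  by rewrite mulrC.
rewrite -mulmxA PE !(mulmxA _ A) XA YA mulmxBl mulmxDl -!mulmxA /Q.
move: (X *m x) (Y *m x) => v w.
pose q i := v i 0 ^+ 2 + w i 0 ^+ 2.
have QE : dotv v v + dotv w w = \sum_i q i.
  by rewrite !dotvE -big_split.
have dmE (M : 'M[R]_n) (a b : 'cV[R]_n) :
    dotv a (M *m b) = \sum_i \sum_j M i j * (a i 0 * b j 0).
  rewrite dotvE; apply: eq_bigr => i _; rewrite mxE mulr_sumr.
  by apply: eq_bigr => j _; rewrite mulrCA.
have -> : - c * (dotv v v + dotv w w) = 2 * (- (c / 2) * \sum_i q i) by rewrite QE; lra.
rewrite dotvDr dotvDr dotvNr !dmE -sumrB -!big_split /=.
rewrite ler_pM2l //.
(* At [j = i] the [W] terms cancel and leave [U i i * q i <= - c * q i]. For [j != i] each of the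
   four products is bounded by the arithmetic-geometric mean inequality, and together they cost
   [d * (q i + q j)]. *)
have bound i : \sum_j U i j * (v i 0 * v j 0) - \sum_j W i j * (v i 0 * w j 0) +
  (\sum_j U i j * (w i 0 * w j 0) + \sum_j W i j * (w i 0 * v j 0)) <=
  - c * q i + \sum_j d * (q i + q j).
  have d_q j : 0 <= d * (q i + q j) by apply: mulr_ge0; rewrite ?(ltW d0) // !addr_ge0 ?sqr_ge0.
  rewrite -sumrB -!big_split /= [leLHS](bigD1 i) //= [X in _ <= _ + X](bigD1 i) //= [leRHS]addrA.
  apply: lerD.
    apply: (@le_trans _ _ (- c * q i)); last by rewrite lerDl.
    apply: (@le_trans _ _ (U i i * q i)).
      by rewrite le_eqVlt; apply/orP; left; apply/eqP; rewrite /q; ring.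
    by rewrite ler_wpM2r ?addr_ge0 ?sqr_ge0 // mxE.
  apply: ler_sum => j ji; have [] := Tij i j; first by rewrite eq_sym.
  rewrite /U /W !mxE /q !ler_norml => /andP[U1 U2] /andP[W1 W2].
  have aux (r a b : R) : - d <= r -> r <= d -> r * (a * b) <= d * ((a ^+ 2 + b ^+ 2) / 2).
    by move=> *; have := sqr_ge0 (a - b); have := sqr_ge0 (a + b); nra.
  have := aux _ (v i 0) (v j 0) U1 U2; have := aux _ (w i 0) (w j 0) U1 U2.
  have := aux _ (w i 0) (v j 0) W1 W2.
  have := aux _ (v i 0) (- w j 0) W1 W2.
  rewrite sqrrN; lra.
apply: (@le_trans _ _ (\sum_i (- c * q i + \sum_j d * (q i + q j)))).
  exact: ler_sum.
rewrite big_split /= -mulr_sumr.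
have -> : \sum_i \sum_j d * (q i + q j) = 2 * n%:R * d * \sum_i q i.
  have const r : \sum_(j < n) r = n%:R * r :> R by rewrite sumr_const card_ord mulr_natl.
  transitivity (\sum_i d * (n%:R * q i + \sum_j q j)).
    by apply: eq_bigr => i _; rewrite -mulr_sumr big_split /= const.
  by rewrite -mulr_sumr big_split /= const -mulr_sumr; ring.
have : 0 <= \sum_i q i by apply: sumr_ge0 => i _; rewrite addr_ge0 ?sqr_ge0.
by move=> /ler_wpM2r/(_ _ _ nd); lra.
Qed.

End Lyap.

(** * Dissipation inequalities for the slow and the coupled dynamics *)

Section Ineq.
Context {R : realType}.

Lemma posdef_unitmx k (M : 'M[R]_k) : posdef M -> M \in unitmx.
Proof.
move=> [_ pM]; rewrite -row_free_unit -kermx_eq0.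
apply: contraT => nz.
have kM : nz_row (kermx M) *m M = 0 by apply/sub_kermxP; exact: nz_row_sub.
have := pM (nz_row (kermx M))^T; rewrite -nz_row_eq0 in nz.
rewrite /qform trmxK kM mul0mx mxE ltxx; apply.
by apply: contra nz => /eqP/(congr1 trmx)/eqP; rewrite trmxK trmx0.
Qed.

(** [v] is recovered from [T^T v] by applying [(T T^T)^-1 T], whose operator bound gives the
    constant. *)
Lemma trmx_mul_lower_bound k l (T : 'M[R]_(k, l)) : posdef (T *m T^T) ->
  exists2 c, 0 < c & forall v, c * dotv v v <= dotv (T^T *m v) (T^T *m v).
Proof.
move=> /posdef_unitmx uT; have [K K0 hK] := dotv_mulmx_bound (invmx (T *m T^T) *m T).
exists K^-1 => [|v]; first by rewrite invr_gt0.
rewrite ler_pdivrMl //; apply: le_trans (hK _).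
by rewrite !mulmxA -(mulmxA _ T) mulVmx // mul1mx.
Qed.

(* With [phi = mu / (L + th)], [th] small, the cross term becomes
   [- 2 phi th <M u, b>]; the positive [th] covers [L = 0]. *)
Lemma sector_multiplier r p (M : 'M[R]_(r, p)) L mu d :
  0 < mu -> 0 < d -> ((0 < r)%N -> 0 <= L) ->
  exists2 phi, 0 < phi & forall u b,
    2 * (phi * L - mu) * dotv (M *m u) b - 2 * phi * dotv b b <=
    d * dotv u u - phi * dotv b b.
Proof.
move=> mu0 d0; case: r M => [|r] M L0.
  exists 1 => // u b; rewrite !(dotvE _ b) !big_ord0.
  by have := mulr_ge0 (ltW d0) (dotv_ge0 u); lra.
have [K K0 hK] := dotv_mulmx_bound M.
(* Since [phi * th <= mu], the cost [phi * th^2 * K] of Young's inequality is at most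
   [mu * th * K = d]. *)
pose th := d / (mu * K); have th0 : 0 < th by rewrite divr_gt0 ?mulr_gt0.
have Lth : 0 < L + th by rewrite ltr_wpDl // L0.
exists (mu / (L + th)) => [|u b]; first exact: divr_gt0.
set phi := mu / _; have phi0 : 0 < phi by exact: divr_gt0.
have -> : phi * L - mu = - (phi * th) by rewrite /phi; field; rewrite gt_eqF.
have y := dotv_young (- (th *: (M *m u))) b (ltr01 : 0 < 1 :> R).
rewrite invr1 !(dotvNl, dotvNr, dotvZl, dotvZr) !mul1r in y.
have phith : phi * th * th * K <= d.
  have -> : d = mu * th * K by rewrite /th; field; rewrite !gt_eqF.
  rewrite ler_pM2r // ler_pM2r // /phi mulrAC ler_pdivrMr // ler_pM2l // ler_wpDl ?L0 //.
have := ler_wpM2l (ltW phi0) y.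
have := ler_wpM2r (dotv_ge0 u) phith.
have := ler_wpM2l (ltW (mulr_gt0 (mulr_gt0 phi0 th0) th0)) (hK u).
lra.
Qed.

(* The dynamics on the slow manifold [x = - G u]. Without the [gam] coupling the form
   vanishes when [u = a = b = 0] and [c = mu l]; there the coupling contributes
   [- 2 gam |T^T l|^2]. *)
Lemma slow_dissipation p r1 r2 (P1 : 'M[R]_(r1, p)) (T : 'M[R]_(r2, p)) m mu L1 L2 :
  0 < m -> 0 < mu -> posdef (T *m T^T) ->
  ((0 < p)%N -> 0 <= L1) -> ((0 < r1)%N -> 0 <= L2) ->
  exists phi1 phi2 gam d, [/\ 0 < phi1, 0 < phi2, 0 < d &
   (forall u l, mu / 2 * (dotv u u + dotv l l) <=
      mu * dotv u u + mu * dotv l l + 2 * gam * dotv u (T^T *m l)) /\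
   forall u l a b c,
   let du := - (m *: u) - a - P1^T *m b - mu^-1 *: (T^T *m c) in
   let dl := - (mu *: l) + c in
   2 * (mu * dotv u du + mu * dotv l dl
        + gam * (dotv u (T^T *m dl) + dotv l (T *m du)))
   + 2 * phi1 * (L1 * dotv u a - dotv a a)
   + 2 * phi2 * (L2 * dotv (P1 *m u) b - dotv b b)
   + 2 * (dotv (T *m u + mu *: l) c - dotv c c) <=
   - d * (dotv u u + dotv l l + dotv a a + dotv b b + dotv c c)].
Proof.
move=> m0 mu0 pT L10 L20.
have mm : 0 < m * mu / 2 by rewrite divr_gt0 ?mulr_gt0.
have [phi1 phi10 sec1] := sector_multiplier (1%:M : 'M[R]_p) mu0 mm L10.
have [phi2 phi20 sec2] := sector_multiplier P1 mu0 mm L20.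
have [c0 c00 hT] := trmx_mul_lower_bound pT.
have [K1 K10 hK1] := dotv_mulmx_bound P1^T.
have [K2 K20 hK2] := dotv_mulmx_bound T^T.
have [K3 K30 hK3] := dotv_mulmx_bound T.
(* [K] sums the coefficients with which the coupling enters [|u|^2], [|a|^2], [|b|^2] and [|e|^2],
   for [e = c - mu l], and those needed for positivity of the form. [Bd] is a lower bound for the
   decay rates available without coupling, and for [mu]. With [gam = Bd / (2 K)] the coupling costs
   at most [Bd / 2] in each. *)
pose K := 4 * m ^+ 2 + K3 + 4 + 4 * K1 + 4 * (mu^-1) ^+ 2 * K2 + 1 + K2.
pose Bd := Num.min (m * mu) (Num.min phi1 (Num.min phi2 (Num.min 1 mu))).
have [Bd0 Bdm Bd1 Bd2 [Bd3 Bd4]] : [/\ 0 < Bd, Bd <= m * mu, Bd <= phi1, Bd <= phi2 &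
    (Bd <= 1 /\ Bd <= mu)].
  by split; [rewrite !lt_min; do ?[apply/andP; split] | | | | split];
    rewrite ?mulr_gt0 // /Bd !ge_min lexx ?orbT.
have mm0 := sqr_ge0 m.
have mu2K : 0 <= (mu^-1) ^+ 2 * K2 by rewrite mulr_ge0 ?sqr_ge0 ?ltW.
have K0 : 0 < K by rewrite /K; lra.
pose gam := Bd / (2 * K).
have gam0 : 0 < gam by rewrite divr_gt0 ?mulr_gt0.
have gamK : gam * K = Bd / 2 by rewrite /gam; field; rewrite gt_eqF.
(* [Bd / 2] is the decay left in [u], [a], [b], [e], and [gam * c0] is the decay in [l] created by
   the coupling. *)
pose d1 := Num.min (Bd / 2) (gam * c0).
have d10 : 0 < d1 by rewrite lt_min divr_gt0 //= mulr_gt0.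
have d1B : d1 <= Bd / 2 by rewrite ge_min lexx.
have d1c : d1 <= gam * c0 by rewrite ge_min lexx orbT.
have mu3 : 0 < 3 + 2 * mu ^+ 2 by have := sqr_ge0 mu; lra.
have gamle k : k <= K -> gam * k <= Bd / 2 by rewrite -gamK ler_pM2l.
(* The factor [3 + 2 mu^2] pays for returning from [e] to [c], by
   [|c|^2 <= 2 |e|^2 + 2 mu^2 |l|^2]. *)
exists phi1, phi2, gam, (d1 / (3 + 2 * mu ^+ 2)); split=> //; first exact: divr_gt0.
split=> [u l|u l a b c].
  have := dotv_young (- u) (T^T *m l) (ltr01 : 0 < 1 :> R).
  rewrite invr1 !(dotvNl, dotvNr) => y.
  have := ler_wpM2l (ltW gam0) y.
  have := ler_wpM2l (ltW gam0) (hK2 l).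
  have g1 : gam * 1 <= Bd / 2 by apply: gamle; rewrite /K; lra.
  have g2 : gam * K2 <= Bd / 2 by apply: gamle; rewrite /K; lra.
  have := ler_wpM2r (dotv_ge0 u) g1; have := ler_wpM2r (dotv_ge0 l) g2.
  have := ler_wpM2r (dotv_ge0 u) Bd4; have := ler_wpM2r (dotv_ge0 l) Bd4.
  lra.
lazy zeta; set du := _ - mu^-1 *: _; set dl := - (mu *: l) + c.
(* The deviation from the degenerate direction [c = mu l]. It equals [dl], and the estimates are
   carried out in [(u, l, a, b, e)]. *)
set e := c - mu *: l.
have cE : c = e + mu *: l by rewrite subrK.
have dlE : dl = e by rewrite /dl addrC.
clearbody dl e.
set t := T^T *m l; set s := T^T *m e; set q := P1^T *m b.
have duE : du = - (m *: u) - a - q - mu^-1 *: s - t.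
  rewrite /du cE mulmxDr scalerDr -scalemxAr scalerA mulVf ?gt_eqF // scale1r.
  by rewrite opprD addrA.
have -> : dotv (T *m u + mu *: l) c = dotv u s + mu * dotv u t + mu * dotv l c.
  by rewrite dotvDl dotvZl dotvC dotv_mulmxr cE mulmxDr -scalemxAr dotvC dotvDr dotvZr.
have bE : dotv (P1 *m u) b = dotv u q by rewrite dotvC dotv_mulmxr dotvC.
rewrite bE dotv_mulmxr (dotv_mulmxr l) dlE -/t trmxK.
have -> : dotv (T *m u) e = dotv u s by rewrite dotvC dotv_mulmxr dotvC.
rewrite duE !(dotvDr, dotvNr, dotvZr).
have sa := sec1 u a; have sb := sec2 u b; rewrite mul1mx in sa; rewrite bE in sb.
(* The coupling supplies [- 2 |t|^2]. With weight 4, each of the four cross terms takes a quarter of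
   [|t|^2], so one full [- |t|^2] remains. *)
have y1 := dotv_young t (- (m *: u)) (ltr0n R 4).
have y2 := dotv_young t (- a) (ltr0n R 4).
have y3 := dotv_young t (- q) (ltr0n R 4).
have y4 := dotv_young t (- (mu^-1 *: s)) (ltr0n R 4).
have y5 := dotv_young (T *m u) e (ltr01 : 0 < 1 :> R).
have T5 : dotv (T *m u) e = dotv u s by rewrite dotvC dotv_mulmxr dotvC.
rewrite !(dotvNl, dotvNr, dotvZl, dotvZr) ?T5 in y1 y2 y3 y4 y5.
have bt := hT l; have bq := hK1 b; have bs := hK2 e; have bu := hK3 u.
rewrite -/t in bt; rewrite -/q in bq; rewrite -/s in bs.
have ycc := dotv_young e (mu *: l) (ltr01 : 0 < 1 :> R).
have ccE : dotv c c = dotv e e + 2 * mu * dotv l e + mu ^+ 2 * dotv l l.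
  by rewrite cE !(dotvDl, dotvDr, dotvZl, dotvZr) (dotvC e l); ring.
have lcE : dotv l c = dotv l e + mu * dotv l l by rewrite cE dotvDr dotvZr.
rewrite ccE lcE; rewrite invr1 !(dotvZl, dotvZr) (dotvC e l) in ycc.
have uu0 := dotv_ge0 u; have aa0 := dotv_ge0 a; have bb0 := dotv_ge0 b.
have ee0 := dotv_ge0 e; have ll0 := dotv_ge0 l.
clearbody t s q; clear cE dlE duE bE T5 ccE lcE du dl hK1 hK2 hK3 hT sec1 sec2.
move: (dotv (T *m u) (T *m u)) (dotv u u) (dotv a a) (dotv b b) (dotv e e) (dotv l l)
  (dotv t t) (dotv s s) (dotv q q) (dotv u a) (dotv u q) (dotv u s) (dotv u t)
  (dotv t u) (dotv t a) (dotv t q) (dotv t s) (dotv l e)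
  bt bq bs bu y1 y2 y3 y4 y5 ycc sa sb uu0 aa0 bb0 ee0 ll0
  => TT uu aa bb ee ll tt ss qq ua uq us ut tu ta tq ts le'.
move=> bt bq bs bu y1 y2 y3 y4 y5 ycc sa sb uu0 aa0 bb0 ee0 ll0.
clearbody d1; have g1 : gam * (4 * m ^+ 2 + K3) <= Bd / 2 by apply: gamle; rewrite /K; lra.
have g2 : gam * 4 <= Bd / 2 by apply: gamle; rewrite /K; lra.
have g3 : gam * (4 * K1) <= Bd / 2 by apply: gamle; rewrite /K; lra.
have g4 : gam * (4 * mu^-1 ^+ 2 * K2 + 1) <= Bd / 2 by apply: gamle; rewrite /K; lra.
clearbody gam Bd; clear gamle gamK mm mu2K mm0 K0 K.
have muus : mu * (mu^-1 * us) = us by rewrite mulVKf ?gt_eqF.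
have cross : 2 * (us - m * tu - ta - tq - tt - mu^-1 * ts) <=
    - tt + (4 * m ^+ 2 + K3) * uu + 4 * aa + 4 * K1 * bb
    + (4 * mu^-1 ^+ 2 * K2 + 1) * ee.
  have := ler_wpM2l (sqr_ge0 mu^-1) bs; lra.
have d1N : d1 * (uu + ll + aa + bb + ee) <=
    Bd / 2 * (uu + aa + bb + ee) + gam * c0 * ll.
  have := ler_wpM2r uu0 d1B; have := ler_wpM2r aa0 d1B; have := ler_wpM2r bb0 d1B.
  have := ler_wpM2r ee0 d1B; have := ler_wpM2r ll0 d1c; lra.
apply: (@le_trans _ _ (- d1 * (uu + ll + aa + bb + ee))).
  have := ler_wpM2l (ltW gam0) cross; have := ler_wpM2l (ltW gam0) bt.
  have := ler_wpM2r uu0 Bdm; have := ler_wpM2r aa0 Bd1; have := ler_wpM2r bb0 Bd2.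
  have := ler_wpM2r ee0 Bd3.
  have := ler_wpM2r uu0 g1; have := ler_wpM2r aa0 g2; have := ler_wpM2r bb0 g3.
  have := ler_wpM2r ee0 g4.
  lra.
rewrite !mulNr lerN2 [leLHS]mulrAC ler_pdivrMr // -[leRHS]mulrA ler_pM2l //.
have := mulr_ge0 (sqr_ge0 mu) uu0; have := mulr_ge0 (sqr_ge0 mu) aa0.
have := mulr_ge0 (sqr_ge0 mu) bb0; have := mulr_ge0 (sqr_ge0 mu) ee0.
have := mulr_ge0 (sqr_ge0 mu) ll0; lra.
Qed.


(* Here [x] is the deviation from the slow manifold, called [xi] in the header. *)
Lemma fast_slow_dissipation n p r1 r2 (A P0 : 'M[R]_n) (G : 'M[R]_(n, p))
    (C1 : 'M[R]_(r1, n)) (C2 : 'M[R]_(r2, n)) (P1 : 'M[R]_(r1, p)) (T : 'M[R]_(r2, p))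
    m mu L1 L2 phi1 phi2 gam c d :
  0 < mu -> 0 < c -> 0 < d ->
  (forall x, 2 * dotv x (P0 *m A *m x) <= - c * dotv x x) ->
  (forall u l a b y,
   let du := - (m *: u) - a - P1^T *m b - mu^-1 *: (T^T *m y) in
   let dl := - (mu *: l) + y in
   2 * (mu * dotv u du + mu * dotv l dl
        + gam * (dotv u (T^T *m dl) + dotv l (T *m du)))
   + 2 * phi1 * (L1 * dotv u a - dotv a a)
   + 2 * phi2 * (L2 * dotv (P1 *m u) b - dotv b b)
   + 2 * (dotv (T *m u + mu *: l) y - dotv y y) <=
   - d * (dotv u u + dotv l l + dotv a a + dotv b b + dotv y y)) ->
  exists eps rho, [/\ 0 < eps, 0 < rho & forall x u l a b y,
   let du := - (m *: u) - a - P1^T *m b - mu^-1 *: (T^T *m y) in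
   let dl := - (mu *: l) + y in
   2 * (dotv x (P0 *m (eps^-1 *: (A *m x) + rho *: x + G *m du))
        + mu * dotv u (du + rho *: u) + mu * dotv l (dl + rho *: l)
        + gam * (dotv u (T^T *m (dl + rho *: l)) + dotv l (T *m (du + rho *: u))))
   + 2 * phi1 * (L1 * dotv u a - dotv a a)
   + 2 * phi2 * (L2 * dotv (C1 *m x + P1 *m u) b - dotv b b)
   + 2 * (dotv (C2 *m x + T *m u + mu *: l) y - dotv y y) <= 0].
Proof.
move=> mu0 c0 d0 lyap slow.
(* Each of [u], [a], [b], [y] meets [x] in at most two cross terms, so weights [d / 8] use at most
   [d / 4] of the slow decay; [d / 2] is kept for the shift by [rho]. *)
have d80 : 0 < d / 8 by rewrite divr_gt0.
have [k1 k10 y1] := dotv_mulmx_young (- (m *: (P0 *m G))) d80.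
have [k2 k20 y2] := dotv_mulmx_young (- (P0 *m G)) d80.
have [k3 k30 y3] := dotv_mulmx_young (- (P0 *m G *m P1^T)) d80.
have [k4 k40 y4] := dotv_mulmx_young (- (mu^-1 *: (P0 *m G *m T^T))) d80.
have [k5 k50 y5] := dotv_mulmx_young ((phi2 * L2) *: C1^T) d80.
have [k6 k60 y6] := dotv_mulmx_young C2^T d80.
have [k7 k70 y7] := dotv_mulmx_young P0 (ltr01 : 0 < 1 :> R).
have [k8 k80 y8] := dotv_mulmx_young (gam *: T^T) (ltr01 : 0 < 1 :> R).
(* [kk] dominates the coefficients of [rho] in front of [|x|^2], [|u|^2] and [|l|^2]. *)
pose kk := k7 + 1 + 2 * mu + 2 * k8 + 2.
have kk0 : 0 < kk by rewrite /kk; lra.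
(* All that must be absorbed in [|x|^2]: the cross terms, and [d / 2] for the shift. With
   [eps = c / k] the fast decay is at least [k |x|^2]. *)
pose k := k1 + k2 + k3 + k4 + k5 + k6 + d / 2.
have k0 : 0 < k by rewrite /k; lra.
pose rho := d / 2 / kk.
have rho0 : 0 < rho by rewrite !divr_gt0.
have rhok : rho * kk = d / 2 by rewrite /rho divfK ?gt_eqF.
exists (c / k), rho; split=> //; first exact: divr_gt0.
move=> x u l a b y; lazy zeta; set du := _ - mu^-1 *: _; set dl := - (mu *: l) + y.
have := slow u l a b y; lazy zeta; rewrite -/du -/dl => {}slow.
have {lyap} := ler_wpM2l (ltW (divr_gt0 k0 c0)) (lyap x).
have -> : k / c * (- c * dotv x x) = - k * dotv x x by field; rewrite gt_eqF.
rewrite invf_div => lyap.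
have duE : 2 * dotv x (P0 *m (G *m du)) <= (k1 + k2 + k3 + k4) * dotv x x
    + d / 8 * (dotv u u + dotv a a + dotv b b + dotv y y).
  have -> : P0 *m (G *m du) = - (m *: (P0 *m G)) *m u + - (P0 *m G) *m a
      + - (P0 *m G *m P1^T) *m b + - (mu^-1 *: (P0 *m G *m T^T)) *m y.
    rewrite mulmxA /du !(mulmxDr, mulmxN, mulNmx, mulmxA).
    by rewrite -!scalemxAr -!scalemxAl !mulmxA.
  rewrite !dotvDr; have := y1 x u; have := y2 x a; have := y3 x b; have := y4 x y.
  lra.
clearbody du dl; have uTl : dotv l (T *m u) = dotv u (T^T *m l) by rewrite dotv_mulmxr dotvC.
have {y5} := y5 x b; rewrite -scalemxAl dotvZr dotv_mulmxr trmxK => y5.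
have {y6} := y6 x y; rewrite dotv_mulmxr trmxK => y6.
have {y7} := y7 x x; have {y8} := y8 u l; rewrite -scalemxAl dotvZr => y8 y7.
rewrite !(mulmxDr, dotvDr, dotvDl) -!scalemxAr !dotvZr uTl.
have {}slow : 2 * (mu * dotv u du + mu * dotv l dl
        + gam * (dotv u (T^T *m dl) + dotv l (T *m du)))
   + 2 * phi1 * (L1 * dotv u a - dotv a a)
   + 2 * phi2 * (L2 * dotv (P1 *m u) b - dotv b b)
   + 2 * (dotv (T *m u) y + dotv (mu *: l) y - dotv y y) <=
   - d * (dotv u u + dotv l l + dotv a a + dotv b b + dotv y y).
  by rewrite -dotvDl.
rewrite -mulmxA in lyap.
have xx := dotv_ge0 x; have uu := dotv_ge0 u; have ll := dotv_ge0 l.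
have aa := dotv_ge0 a; have bb := dotv_ge0 b; have yy := dotv_ge0 y.
have {y7} := ler_wpM2l (ltW rho0) y7; have {y8} := ler_wpM2l (ltW rho0) y8 => y8 y7.
have r1' : rho * (k7 + 1) <= d / 2 by rewrite -rhok ler_pM2l // /kk; lra.
have r2' : rho * (2 * mu + 2 * k8) <= d / 2 by rewrite -rhok ler_pM2l // /kk; lra.
have r3' : rho * (2 * mu + 2) <= d / 2 by rewrite -rhok ler_pM2l // /kk; lra.
have := ler_wpM2r xx r1'; have := ler_wpM2r uu r2'; have := ler_wpM2r ll r3'.
have := mulr_ge0 (ltW d0) uu; have := mulr_ge0 (ltW d0) ll.
have := mulr_ge0 (ltW d0) aa; have := mulr_ge0 (ltW d0) bb.
have := mulr_ge0 (ltW d0) yy.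
have kxx : k * dotv x x = (k1 + k2 + k3 + k4 + k5 + k6 + d / 2) * dotv x x by [].
clearbody rho k; lra.
Qed.

End Ineq.

(** * Block matrix computations and the reduction of the LMI to a dissipation inequality *)

Section Blocks.
Context {R : realType}.

Lemma dotv_col_mx k l (u u' : 'cV[R]_k) (v v' : 'cV[R]_l) :
  dotv (col_mx u v) (col_mx u' v') = dotv u u' + dotv v v'.
Proof. by rewrite /dotv tr_col_mx mul_row_col mxE. Qed.

Lemma qform_dotv k (M : 'M[R]_k) x : qform M x = dotv x (M *m x).
Proof. by rewrite /qform /dotv mulmxA. Qed.

(** Evaluated at the stacked vector [(z, w)], the LMI form is the derivative of [z^T P z] along
    [A' z + Bb w] plus the multiplier form at [(Cb z, w)]; symmetry of [P] merges the two transposed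
    products. *)
Lemma LMI_dissipation N K (A' : 'M[R]_N) (Bb : 'M[R]_(N, K)) (Cb : 'M[R]_(K, N)) P X :
  P^T = P -> X^T = X ->
  (forall z w, 2 * dotv z (P *m (A' *m z + Bb *m w)) + qform X (col_mx (Cb *m z) w) <= 0) ->
  LMI A' Bb Cb P X.
Proof.
move=> PT XT H; rewrite /LMI; split=> [|x].
  rewrite linearD /= tr_block_mx !linearD /= !trmx_mul !trmxK PT XT trmx0 mulmxA.
  by rewrite (addrC (P *m A')).
rewrite -(vsubmxK x); set z := usubmx x; set w := dsubmx x.
apply: le_trans (H z w); rewrite le_eqVlt; apply/orP; left; apply/eqP.
rewrite !qform_dotv mulmxDl dotvDr; congr (_ + _); last first.
  rewrite -!mulmxA dotv_mulmxr trmxK mul_block_col.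
  by rewrite !mul0mx addr0 add0r mul1mx.
rewrite mul_block_col dotv_col_mx mul0mx addr0 mulmxDl !mulmxDr !dotvDr.
rewrite -!mulmxA.
have -> : dotv z (A'^T *m (P *m z)) = dotv z (P *m (A' *m z)).
  by rewrite dotv_mulmxr trmxK (dotv_mulmxr z) PT dotvC.
have -> : dotv w (Bb^T *m (P *m z)) = dotv z (P *m (Bb *m w)).
  by rewrite dotv_mulmxr trmxK (dotv_mulmxr z) PT dotvC.
ring.
Qed.

Lemma diag3T p r1 r2 (a b c : R) : (diag3 p r1 r2 a b c)^T = diag3 p r1 r2 a b c.
Proof. by rewrite /diag3 !tr_block_mx !trmx0 !tr_scalar_mx. Qed.

Lemma mul_diag3 p r1 r2 (a b c : R)
    (x : 'cV_p) (y : 'cV_r1) (z : 'cV_r2) :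
  diag3 p r1 r2 a b c *m col_mx (col_mx x y) z = col_mx (col_mx (a *: x) (b *: y)) (c *: z).
Proof.
by rewrite /diag3 !mul_block_col !mul0mx !addr0 !add0r !mul_scalar_mx.
Qed.

Lemma qform_Xi p r1 r2 (hLf Lh phi1 phi2 : R)
    (x a : 'cV_p) (y b : 'cV_r1) (z c : 'cV_r2) :
  qform (Xi p r1 r2 hLf Lh phi1 phi2)
    (col_mx (col_mx (col_mx x y) z) (col_mx (col_mx a b) c)) =
  2 * phi1 * (hLf * dotv x a - dotv a a) + 2 * phi2 * (Lh * dotv y b - dotv b b)
  + 2 * (dotv z c - dotv c c).
Proof.
rewrite qform_dotv /Xi mul_block_col mul0mx add0r !mul_diag3 !dotv_col_mx dotvDr.
rewrite !dotv_col_mx !dotvZr.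
rewrite (dotvC a x) (dotvC b y) (dotvC c z); ring.
Qed.

Lemma XiT p r1 r2 (hLf Lh phi1 phi2 : R) :
  (Xi p r1 r2 hLf Lh phi1 phi2)^T = Xi p r1 r2 hLf Lh phi1 phi2.
Proof. by rewrite /Xi tr_block_mx !diag3T trmx0. Qed.

(* The matrix of [xi^T P0 xi + mu |u|^2 + mu |l|^2 + 2 gam <u, T^T l>], [xi = x + G u]. *)
Definition lyapunov_mx n p r2 (P0 : 'M[R]_n) (G : 'M[R]_(n, p)) (T : 'M[R]_(r2, p)) mu gam :
    'M[R]_(n + p + r2) :=
  block_mx (block_mx P0 (P0 *m G) (G^T *m P0) (G^T *m P0 *m G + mu%:M))
    (col_mx 0 (gam *: T^T)) (row_mx 0 (gam *: T)) (mu%:M).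

Lemma lyapunov_mxT n p r2 (P0 : 'M[R]_n) (G : 'M[R]_(n, p)) (T : 'M[R]_(r2, p)) mu gam :
  P0^T = P0 -> (lyapunov_mx P0 G T mu gam)^T = lyapunov_mx P0 G T mu gam.
Proof.
move=> PT; rewrite /lyapunov_mx !tr_block_mx tr_row_mx tr_col_mx !trmx0 linearD /=.
by rewrite !tr_scalar_mx !trmx_mul !trmxK PT !linearZ /= trmxK mulmxA.
Qed.

(** The polarized form serves twice: with equal arguments for positivity, and with the velocity as
    second argument for the derivative of the form. *)
Lemma lyapunov_mx_dotv n p r2 (P0 : 'M[R]_n) (G : 'M[R]_(n, p)) (T : 'M[R]_(r2, p)) mu gam
    (x x' : 'cV_n) (u u' : 'cV_p) (l l' : 'cV_r2) :
  dotv (col_mx (col_mx x u) l) (lyapunov_mx P0 G T mu gam *m col_mx (col_mx x' u') l') =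
  dotv (x + G *m u) (P0 *m (x' + G *m u')) + mu * dotv u u' + mu * dotv l l'
  + gam * (dotv u (T^T *m l') + dotv l (T *m u')).
Proof.
rewrite /lyapunov_mx mul_block_col !mul_block_col mul_col_mx mul_row_col !mul0mx.
rewrite !add_col_mx !addr0 !add0r !dotv_col_mx !mulmxDl !mul_scalar_mx -!scalemxAl.
rewrite !(dotvDr, dotvDl, mulmxDr) !dotvZr !mulmxA.
rewrite -!(mulmxA G^T) -!mulmxA !(dotv_mulmxr u G^T) !trmxK !mulmxA; ring.
Qed.

Lemma lyapunov_mx_posdef n p r2 (P0 : 'M[R]_n) (G : 'M[R]_(n, p)) (T : 'M[R]_(r2, p)) mu gam :
  0 < mu -> posdef P0 ->
  (forall u l, mu / 2 * (dotv u u + dotv l l) <=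
      mu * dotv u u + mu * dotv l l + 2 * gam * dotv u (T^T *m l)) ->
  posdef (lyapunov_mx P0 G T mu gam).
Proof.
move=> mu0 [PT Ppos] Hul; split=> [|z]; first exact: lyapunov_mxT.
rewrite -(vsubmxK z) -(vsubmxK (usubmx z)).
move: (usubmx (usubmx z)) (dsubmx (usubmx z)) (dsubmx z) => x u l nz.
rewrite qform_dotv lyapunov_mx_dotv -qform_dotv.
have P0ge0 y : 0 <= qform P0 y.
  have [->|/Ppos/ltW//] := eqVneq y 0; by rewrite qform_dotv mulmx0 dotv0r.
have -> : dotv l (T *m u) = dotv u (T^T *m l) by rewrite dotv_mulmxr dotvC.
have Hul' := Hul u l.
(* If [(u, l)] is nonzero, its coercive part is already positive. Otherwise the form reduces to that
   of [P0] at [x], which is then nonzero. *)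
have [ul0|ul0] := leP (dotv u u + dotv l l) 0; last first.
  by have := P0ge0 (x + G *m u); have := mulr_gt0 mu0 ul0; lra.
have u0 : u = 0.
  by apply/eqP; rewrite -[_ == _]negbK -dotv_gt0 -leNgt; have := dotv_ge0 l; lra.
have l0 : l = 0.
  by apply/eqP; rewrite -[_ == _]negbK -dotv_gt0 -leNgt; have := dotv_ge0 u; lra.
move: nz; rewrite u0 l0 !mulmx0 !dotv0r !addr0 !mulr0 !addr0 => nz; apply: Ppos.
by apply: contra nz => /eqP->; rewrite !col_mx0.
Qed.

Lemma closed_loopE n p r1 r2 (A : 'M[R]_n) (B : 'M[R]_(n, p))
    (P1 : 'M[R]_(r1, p)) (P2 : 'M[R]_(r2, p)) m mu eps rho
    (x : 'cV_n) (u a : 'cV_p) (l c : 'cV_r2) (b : 'cV_r1) :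
  Aepsrho r2 A B m mu eps rho *m col_mx (col_mx x u) l
    + Bbold n P1 P2 mu *m col_mx (col_mx a b) c =
  col_mx (col_mx (eps^-1 *: (A *m x + B *m u) + rho *: x)
    (- (m *: u) - a - P1^T *m b - mu^-1 *: (P2^T *m c) + rho *: u))
    (- (mu *: l) + c + rho *: l).
Proof.
rewrite /Aepsrho /Aeps /Bbold mulmxDl !mul_block_col !mul_col_mx !mul_row_col !mul0mx.
rewrite !mulNmx !mul1mx -!scalemxAl !mul_scalar_mx scale_col_mx !addr0 !add0r.
rewrite scale_col_mx !add_col_mx !addr0 -scalerDr.
congr (col_mx (col_mx _ _) _).
  by rewrite addrAC -!addrA; congr (_ + _); rewrite addrC -!addrA.
by rewrite addrAC.
Qed.

Lemma outputE n p r1 r2 (C1 : 'M[R]_(r1, n)) (C2 : 'M[R]_(r2, n)) mu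
    (x : 'cV_n) (u : 'cV_p) (l : 'cV_r2) :
  Cbold p C1 C2 mu *m col_mx (col_mx x u) l =
  col_mx (col_mx u (C1 *m x)) (C2 *m x + mu *: l).
Proof.
rewrite /Cbold mul_block_col mul_col_mx !mul_row_col !mul0mx !addr0 !add0r mul1mx.
by rewrite mul_scalar_mx.
Qed.

End Blocks.

Theorem theorem2 (R : realType) (n p r1 r2 : nat)
  (A : 'M[R]_n) (B : 'M[R]_(n, p)) (C1 : 'M[R]_(r1, n)) (C2 : 'M[R]_(r2, n))
  (m Lf Lh mu : R)
  (f : R -> 'cV[R]_p -> R) (df : R -> 'cV[R]_p -> 'cV[R]_p)
  (h : R -> 'cV[R]_r1 -> R) (dh : R -> 'cV[R]_r1 -> 'cV[R]_r1)
  (g : R -> 'cV[R]_r2 -> \bar R) :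
  hurwitz A ->
  0 < mu ->
  assumption1 m Lf Lh f df h dh g ->
  posdef (Piu A B C2 *m (Piu A B C2)^T) ->
  Num.max (Lf - m) Lh <= mu ->
  exists (eps rho phi1 phi2 : R) (P : 'M[R]_(n + p + r2)),
    [/\ 0 < eps, 0 < rho, 0 <= phi1, 0 <= phi2 &
      posdef P /\
      LMI (Aepsrho r2 A B m mu eps rho)
          (Bbold n (Piu A B C1) (Piu A B C2) mu)
          (Cbold p C1 C2 mu)
          P
          (Xi p r1 r2 (Lf - m) Lh phi1 phi2)].
Proof.
move=> hA mu0 asm pT _.
(* The constants are uniform in time, so their signs can be read off at time 0. *)
have [[gf [sf lf]] [[_ [_ lh]] _]] := asm 0 (lexx 0).
have m0 : 0 < m by case: sf.
(* The signs are claimed in positive dimension only: on a zero-dimensional space a Lipschitz bound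
   says nothing about the sign of its constant. *)
have L10 : (0 < p)%N -> 0 <= Lf - m.
  by move=> p0; rewrite subr_ge0; apply: gradient_lipschitz_ge p0 gf sf lf.
have L20 : (0 < r1)%N -> 0 <= Lh.
  move=> r10; pose v : 'cV[R]_r1 := const_mx 1.
  have v0 : 0 < norm2 v.
    by rewrite sqrtr_gt0 dotv_gt0; apply/eqP => /colP/(_ (Ordinal r10))/eqP;
      rewrite !mxE oner_eq0.
  have := le_trans (sqrtr_ge0 _) (lh v 0); rewrite subr0.
  by rewrite pmulr_lge0.
have [P0 [pP0 [c c0 lyap]]] := hurwitz_lyapunov hA.
have [phi1 [phi2 [gam [d [phi10 phi20 d0 [Vpos slow]]]]]] :=
  slow_dissipation (Piu A B C1) m0 mu0 pT L10 L20.
have [eps [rho [eps0 rho0 full]]] :=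
  fast_slow_dissipation (invmx A *m B) C1 C2 mu0 c0 d0 lyap slow.
exists eps, rho, phi1, phi2, (lyapunov_mx P0 (invmx A *m B) (Piu A B C2) mu gam).
split=> //; [exact: ltW|exact: ltW|split].
  exact: lyapunov_mx_posdef.
apply: LMI_dissipation; [by apply: lyapunov_mxT; case: pP0|exact: XiT|].
move=> z w; rewrite -(vsubmxK z) -(vsubmxK (usubmx z)) -(vsubmxK w) -(vsubmxK (usubmx w)).
move: (usubmx (usubmx z)) (dsubmx (usubmx z)) (dsubmx z) => x u l.
move: (usubmx (usubmx w)) (dsubmx (usubmx w)) (dsubmx w) => a b y.
rewrite closed_loopE outputE qform_Xi lyapunov_mx_dotv.
have Au := hurwitz_unitmx hA.
(* As [Pi_iu = - C_i A^-1 B], the output [C_i x] is [C_i xi + Pi_iu u] in the shifted variable. *)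
have outE k (C : 'M[R]_(k, n)) :
    C *m (x + invmx A *m B *m u) + Piu A B C *m u = C *m x.
  by rewrite /Piu mulmxDr mulNmx !mulmxA addrK.
have := full (x + invmx A *m B *m u) u l a b y; lazy zeta; rewrite !outE.
set du := _ - mu^-1 *: _; set dl := - (mu *: l) + y => bound.
clearbody du dl.
(* The velocity of [xi = x + G u]: since [A G = B], the plant contributes [eps^-1 A xi], the shifts
   combine to [rho xi], and [G du] is the drift of the slow manifold. *)
have -> : eps^-1 *: (A *m x + B *m u) + rho *: x + invmx A *m B *m (du + rho *: u) =
    eps^-1 *: (A *m (x + invmx A *m B *m u)) + rho *: (x + invmx A *m B *m u)
    + invmx A *m B *m du.
  rewrite !mulmxDr !mulmxA mulmxV // mul1mx -scalemxAr scalerDr [rho *: (x + _)]scalerDr.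
  by rewrite [_ *m du + _]addrC !addrA.
by rewrite 2!(addrA (2 * _)).
Qed.
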